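(* Let $(X,\|\cdot\|)$ be a Banach space, let $b\in[0,\infty)$, $a\in[0,1)$, $\alpha\in(0,1)$, and let $T:X\to X$ be an $(a,b,\alpha)$-enriched interpolative Kannan type operator. Then the fixed point problem of $T$ is Ulam-Hyers stable.
   Context: A map $T:X\to X$ on a normed space $(X,\|\cdot\|)$ is called an $(a,b,\alpha)$-enriched interpolative Kannan type operator, where $b\in[0,\infty)$, $a\in[0,1)$ and $\alpha\in(0,1)$, if for all $x,y\in X$ $$\|b(x-y)+(Tx-Ty)\|\le a\,\|x-Tx\|^{\alpha}\,\|y-Ty\|^{1-\alpha}.$$ Let $(X,d)$ be a metric space and $T:X\to X$. For $\epsilon>0$, a point $w^*\in X$ is an $\epsilon$-solution of the fixed point problem of $T$ if $d(w^*,Tw^* )\le\epsilon$. The fixed point problem of $T$ is generalized Ulam-Hyers stable if there is an increasing continuous function $\phi:[0,\infty)\to[0,\infty)$ with $\phi(0)=0$ such that for each $\epsilon>0$ and each $\epsilon$-solution $w^*\in X$ there exists a solution $x^*\in X$ of $Tx=x$ with $d(x^*,w^* )\le\phi(\epsilon)$. It is Ulam-Hyers stable if this holds with $\phi(t)=mt$ for all $t\ge 0$, for some constant $m>0$. On a normed space, $d(x,y)=\|x-y\|$. *)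

(* Defs.v *)
From HB Require Import structures.
From mathcomp Require Import all_boot all_order all_algebra.
From mathcomp Require Import all_classical all_reals all_analysis.

Set Implicit Arguments.
Unset Strict Implicit.
Unset Printing Implicit Defensive.

Import Order.TTheory GRing.Theory Num.Theory.
Import numFieldNormedType.Exports.

Local Open Scope classical_set_scope.
Local Open Scope ring_scope.

(* The inequality is required for all x and y, fixed points of T included. The
   exponents are positive, so [powR] gives 0 `^ alpha = 0 `^ (1 - alpha) = 0. *)
Definition enriched_interpolative_kannan (R : realType) (X : normedModType R)
    (a b alpha : R) (T : X -> X) : Prop :=
  [/\ 0 <= b, 0 <= a < 1, 0 < alpha < 1 &
    forall x y : X,
      `|b *: (x - y) + (T x - T y)|
        <= a * `|x - T x| `^ alpha * `|y - T y| `^ (1 - alpha)].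

(* The notions below take the distance [d] as an explicit argument, because the
   library has no [metricType] instance on an arbitrary [normedModType]. *)
Definition norm_dist (R : realType) (X : normedModType R) (x y : X) : R :=
  `|x - y|.

Definition fixpoint_eps_solution (R : realType) (X : Type) (d : X -> X -> R)
    (T : X -> X) (eps : R) (w : X) : Prop :=
  d w (T w) <= eps.

Definition ulam_hyers_bound (R : realType) (X : Type) (d : X -> X -> R)
    (T : X -> X) (phi : R -> R) : Prop :=
  forall eps : R, 0 < eps ->
  forall w : X, fixpoint_eps_solution d T eps w ->
  exists x : X, T x = x /\ d x w <= phi eps.

(* Only the values of [phi] on [0, +oo[ matter; strict monotonicity and
   [phi 0 = 0] make them nonnegative. *)
Definition generalized_ulam_hyers_stable (R : realType) (X : Type)
    (d : X -> X -> R) (T : X -> X) : Prop :=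
  exists phi : R -> R,
    [/\ {in `[0, +oo[ &, {homo phi : s t / s < t}},
        {within `[0, +oo[, continuous phi},
        phi 0 = 0 &
        ulam_hyers_bound d T phi].

(* The map t |-> m * t with 0 < m satisfies all the conditions on [phi] in
   [generalized_ulam_hyers_stable], so they are not repeated. *)
Definition ulam_hyers_stable (R : realType) (X : Type) (d : X -> X -> R)
    (T : X -> X) : Prop :=
  exists m : R, 0 < m /\ ulam_hyers_bound d T (fun t => m * t).

(* Main.v *)
(** The averaged map [S x = (b + 1)^-1 *: (b *: x + T x)] has the same fixed
    points as [T], and it satisfies the interpolative Kannan inequality with
    [b = 0]. As a weighted geometric mean is at most the maximum, [S] is a
    Bianchini contraction: [`|S x - S y| <= a * max (`|x - S x|, `|y - S y|)].
    This inequality alone gives [`|S x - S (S x)| <= a * `|x - S x|] along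
    orbits, the Cauchy property, the fixed point [p], and the estimate
    [`|p - w| <= (1 + a) * `|w - S w|]. *)
Require Import Defs.
From mathcomp Require Import all_boot all_order all_algebra.
From mathcomp Require Import all_classical all_reals all_analysis.

Import Order.TTheory GRing.Theory Num.Theory.
Import numFieldNormedType.Exports.

Local Open Scope ring_scope.

Lemma powR_interp_le_max (R : realType) (alpha x y : R) :
  0 < alpha < 1 -> 0 <= x -> 0 <= y ->
  x `^ alpha * y `^ (1 - alpha) <= Num.max x y.
Proof.
move=> /andP[alpha_gt0 alpha_lt1] x0 y0.
have M0 : 0 <= Num.max x y by rewrite le_max x0.
rewrite -[leRHS]powRr1// -[in leRHS](subrKC alpha 1).
(* The exponents sum to 1, which is nonzero, so [powRD] also covers a maximum equal to 0. *)
rewrite [leRHS]powRD; last by rewrite subrKC oner_eq0.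
apply: ler_pM; rewrite ?powR_ge0//.
- by rewrite ge0_ler_powR ?nnegrE ?le_max ?lexx ?x0// ltW.
- by rewrite ge0_ler_powR ?nnegrE ?le_max ?lexx ?x0 ?orbT// subr_ge0 ltW.
Qed.

Section Bianchini.
Context {R : realType} {X : completeNormedModType R} (a : R) (S : X -> X).
Hypothesis a01 : 0 <= a < 1.
Hypothesis S_bianchini : forall x y,
  `|S x - S y| <= a * Num.max `|x - S x| `|y - S y|.

Let a_ge0 : 0 <= a. Proof. by case/andP: a01. Qed.
Let a_lt1 : a < 1. Proof. by case/andP: a01. Qed.

Lemma bianchini_dist_le (e : R) x y :
  `|x - S x| <= e -> `|y - S y| <= e -> `|S x - S y| <= a * e.
Proof.
move=> xe ye; apply: (le_trans (S_bianchini x y)).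
by rewrite ler_wpM2l// ge_max xe.
Qed.

(** If the second displacement were the larger, [bianchini_dist_le] with that value as [e] would
    bound a positive number by [a] times itself, against [a < 1]. *)
Lemma bianchini_step x : `|S x - S (S x)| <= a * `|x - S x|.
Proof.
have [//|lt_step] := leP `|S x - S (S x)| `|x - S x|.
  exact: bianchini_dist_le.
have := bianchini_dist_le _ _ _ (ltW lt_step) (lexx _).
by rewrite leNgt gtr_pMl ?a_lt1// (le_lt_trans _ lt_step).
Qed.

Lemma bianchini_orbit x n :
  `|iter n S x - iter n.+1 S x| <= geometric `|x - S x| a n.
Proof.
elim: n => [|n IHn] /=; first by rewrite expr0 mulr1.
apply: (le_trans (bianchini_step _)).
by rewrite exprS mulrCA ler_wpM2l.
Qed.

Lemma bianchini_orbit_near x (e : R) : 0 < e ->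
  (\forall n \near \oo, `|iter n S x - iter n.+1 S x| <= e)%classic.
Proof.
move=> e_gt0.
have a1 : `|a| < 1 by rewrite ger0_norm.
have /cvgr_le/(_ _ e_gt0) := cvg_geometric `|x - S x| a1.
by apply: filterS => n; exact/le_trans/bianchini_orbit.
Qed.

Lemma bianchini_orbit_cvg x : cvgn (fun n => iter n.+1 S x).
Proof.
apply/cauchy_cvgP/cauchy_exP => e e_gt0.
have [N _ orbit_le] := bianchini_orbit_near x _ e_gt0.
(* No geometric series is summed: two late iterates both have displacement at most [e], so their
   images lie within [a * e < e]. Taking images is what shifts the index to [n.+1]. *)
exists (iter N.+1 S x), N => // n /= leNn.
rewrite -ball_normE /=.
apply: (@le_lt_trans _ _ (a * e)); last by rewrite gtr_pMl.
by apply: bianchini_dist_le; apply: orbit_le => /=.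
Qed.

Lemma bianchini_fixpoint : exists p, S p = p.
Proof.
set p := limn (fun n => iter n.+1 S 0); exists p.
have orbit_p : ((fun n => iter n.+1 S 0) @ \oo --> p)%classic.
  exact: bianchini_orbit_cvg.
(* [S] need not be continuous. If [D = |p - S p|] is positive, late iterates have displacement at
   most [D], so their images stay within [a * D] of [S p]; the limit gives [D <= a * D]. *)
apply/eqP; rewrite eq_sym -subr_eq0 -normr_le0 leNgt; apply/negP => D_gt0.
have : `|p - S p| <= a * `|p - S p|.
  have : ((fun n => `|iter n.+1 S 0 - S p|) @ \oo --> `|p - S p|)%classic.
    by apply: cvg_norm; apply: cvgB => //; exact: cvg_cst.
  move/cvgr_to_le; apply; near=> n.
  apply: bianchini_dist_le => //.
  by near: n; exact: bianchini_orbit_near.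
by rewrite leNgt gtr_pMl ?a_lt1.
Unshelve. all: by end_near. Qed.

Lemma bianchini_dist_fixpoint p w :
  S p = p -> `|p - w| <= (1 + a) * `|w - S w|.
Proof.
move=> Sp; rewrite distrC mulrDl mul1r.
apply: (le_trans (ler_distD (S w) _ _)); rewrite lerD2l -{1}Sp.
(* The displacement of [p] is 0, so that of [w] bounds both. *)
by apply: bianchini_dist_le => //; rewrite Sp subrr normr0.
Qed.

End Bianchini.

Section Averaged.
Context {R : realType} {X : normedModType R} (b : R) (T : X -> X).
Hypothesis b_ge0 : 0 <= b.

Definition averaged (x : X) : X := (b + 1)^-1 *: (b *: x + T x).

Let b1_gt0 : 0 < b + 1. Proof. by rewrite ltr_wpDl. Qed.

Lemma averaged_displacement x : x - averaged x = (b + 1)^-1 *: (x - T x).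
Proof.
rewrite -{1}[x](scalerK (lt0r_neq0 b1_gt0)) -scalerBr scalerDl scale1r.
by rewrite opprD addrACA subrr add0r.
Qed.

Lemma averaged_sub x y :
  averaged x - averaged y = (b + 1)^-1 *: (b *: (x - y) + (T x - T y)).
Proof. by rewrite -scalerBr opprD addrACA -scalerBr. Qed.

Lemma averaged_fixpoint x : averaged x = x -> T x = x.
Proof.
move/eqP; rewrite eq_sym -subr_eq0 averaged_displacement scaler_eq0.
by rewrite invr_eq0 gt_eqF//= subr_eq0 => /eqP.
Qed.

Lemma averaged_bianchini (a alpha : R) :
  enriched_interpolative_kannan a b alpha T ->
  forall x y, `|averaged x - averaged y|
    <= a * Num.max `|x - averaged x| `|y - averaged y|.
Proof.
case=> _ /andP[a_ge0 _] alpha01 kannan x y.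
rewrite averaged_sub !averaged_displacement !normrZ.
(* The factor [|(b + 1)^-1|] comes out of the maximum and cancels against the one on the left. *)
rewrite -maxr_pMr// mulrCA ler_wpM2l//.
apply: (le_trans (kannan x y)).
by rewrite -mulrA ler_wpM2l// powR_interp_le_max.
Qed.

End Averaged.

Theorem theorem3p3p3 (R : realType) (X : completeNormedModType R)
    (a b alpha : R) (hb : 0 <= b) (ha : 0 <= a < 1) (halpha : 0 < alpha < 1)
    (T : X -> X) (hT : enriched_interpolative_kannan a b alpha T) :
  ulam_hyers_stable (@norm_dist R X) T.
Proof.
have S_bianchini := averaged_bianchini _ _ hb _ _ hT.
have [p Sp] := bianchini_fixpoint _ _ ha S_bianchini.
have a_ge0 : 0 <= a by case/andP: ha.
exists (1 + a); split; first by rewrite ltr_pwDl.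
move=> eps _ w w_eps; exists p; split; first exact: averaged_fixpoint Sp.
apply: (le_trans (bianchini_dist_fixpoint _ _ ha S_bianchini _ w Sp)).
(* As [(b + 1)^-1 <= 1], averaging does not increase displacements, so the bound [eps] for [T] holds
   for the averaged map too. *)
rewrite ler_wpM2l ?addr_ge0// averaged_displacement// normrZ.
apply: le_trans w_eps; rewrite ler_piMl//.
by rewrite ger0_norm ?invr_ge0 ?addr_ge0// invf_le1 ?ltr_wpDl// lerDr.
Qed.
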